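(* Let $T$ be an achronal localization (AL) on a separable Hilbert space $\mathcal{H}$. Let $\Delta\subset\mathbb{R}^4$ be achronal and let $\Sigma$ be a causal base. (a) If $\Delta$ is a Suslin set, then $\Delta_\Sigma$ is $T$-measurable. (b) If $\Delta$ and $\Delta_\Sigma$ are $T$-measurable, then the causality condition $T(\Delta)\le T(\Delta_\Sigma)$ holds.
   Context: Points of $\mathbb{R}^4$ are $\mathfrak{x}=(x_0,x)$, $x\in\mathbb{R}^3$; $\mathfrak{a}\cdot\mathfrak{b}:=a_0b_0-a_1b_1-a_2b_2-a_3b_3$, $\mathfrak{a}^{\cdot 2}:=\mathfrak{a}\cdot\mathfrak{a}$. A set $\Delta\subset\mathbb{R}^4$ is achronal if $(\mathfrak{x}-\mathfrak{y})^{\cdot2}\le0$ for all $\mathfrak{x},\mathfrak{y}\in\Delta$; maximal achronal if it is achronal and not properly contained in an achronal set; spacelike if $(\mathfrak{x}-\mathfrak{y})^{\cdot2}<0$ for all different $\mathfrak{x},\mathfrak{y}\in\Delta$. A causal line is a straight line $\mathfrak{a}+\mathbb{R}\mathfrak{z}$ with $\mathfrak{z}\ne0$, $\mathfrak{z}^{\cdot2}\ge0$. A causal base is a spacelike set that intersects all causal lines. The region of influence of $\Delta$ in $\Sigma$ is $\Delta_\Sigma:=\{\mathfrak{x}\in\Sigma:\exists\,\mathfrak{z}\in\Delta\text{ with }(\mathfrak{x}-\mathfrak{z})^{\cdot2}\ge0\}$. Suslin sets are the analytic (Suslin) subsets of $\mathbb{R}^4$. $\mathcal{B}^{ach}$ is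 the set of achronal Borel subsets of $\mathbb{R}^4$. An achronal localization (AL) on $\mathcal{H}$ is a map $T$ assigning to each $\Delta\in\mathcal{B}^{ach}$ a nonnegative bounded operator $T(\Delta)$ on $\mathcal{H}$ with $T(\emptyset)=0$ and $\sum_nT(\Delta_n)=I$ for every sequence $(\Delta_n)$ of mutually disjoint sets in $\mathcal{B}^{ach}$ such that $\bigcup_n\Delta_n$ is maximal achronal. A set $Y\subset\mathbb{R}^4$ is $T$-measurable if there are $B,C\in\mathcal{B}^{ach}$ with $B\subset Y\subset C$ and $T(C\setminus B)=0$; in this case $T(Y):=T(B)$ (this is independent of the choice of $B,C$ and extends $T$). *)

(* Defs.v *)
From mathcomp Require Import all_boot all_order all_algebra.
From mathcomp Require Import all_classical all_reals all_analysis.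
From mathcomp Require Export complex.
Export numFieldNormedType.Exports.

Set Implicit Arguments.
Unset Strict Implicit.
Unset Printing Implicit Defensive.

Import Order.TTheory GRing.Theory Num.Theory.

Local Open Scope classical_set_scope.
Local Open Scope ring_scope.
Local Open Scope complex_scope.

Definition separable (X : topologicalType) : Prop :=
  exists2 D : set X, countable D & dense D.

Section Minkowski.
Variable R : realType.

Definition mink (a b : 'rV[R]_4) : R :=
  a 0 0 * b 0 0 - a 0 1 * b 0 1 - a 0 2 * b 0 2 - a 0 3 * b 0 3.

Definition minksq (a : 'rV[R]_4) : R := mink a a.

Definition achronal (D : set 'rV[R]_4) : Prop :=
  forall x y, D x -> D y -> minksq (x - y) <= 0.

Definition maximal_achronal (D : set 'rV[R]_4) : Prop :=
  achronal D /\ forall E, achronal E -> D `<=` E -> E = D.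

Definition spacelike (D : set 'rV[R]_4) : Prop :=
  forall x y, D x -> D y -> x <> y -> minksq (x - y) < 0.

Definition causal_line (L : set 'rV[R]_4) : Prop :=
  exists a z : 'rV[R]_4,
    [/\ z <> 0, 0 <= minksq z & L = [set a + s *: z | s in [set: R]]].

Definition causal_base (S : set 'rV[R]_4) : Prop :=
  spacelike S /\ forall L, causal_line L -> S `&` L !=set0.

Definition region_of_influence (D S : set 'rV[R]_4) : set 'rV[R]_4 :=
  [set x | S x /\ exists2 z, D z & 0 <= minksq (x - z)].

Definition borel_achronal (D : set 'rV[R]_4) : Prop :=
  <<s [set U : set 'rV[R]_4 | open U] >> D /\ achronal D.

(* Continuous images of Polish spaces.  The complete uniform spaces of the
   library are pointed, hence the separate clause for the empty set; the
   Hausdorff condition turns the pseudometric into a metric. *)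
Definition suslin (A : set 'rV[R]_4) : Prop :=
  A = set0 \/
  exists (P : completePseudoMetricType R) (f : P -> 'rV[R]_4),
    [/\ hausdorff_space P, separable P, continuous f & range f = A].

End Minkowski.

Section Localization.
Variables (R : realType) (H : completeNormedModType R[i]).
Variable dot : {dot H for Num.conj}.

(* The norm of H, for which H is complete, is the one given by [dot], which is
   linear in its first argument. *)
Definition inner_product_norm : Prop := forall v : H, `|v| ^+ 2 = dot v v.

Definition bounded_op (A : {linear H -> H}) : Prop :=
  exists M : R, forall v, `|A v| <= M%:C * `|v|.

(* The order of R[i] is partial: 0 <= c includes that c is real. *)
Definition nonneg_op (A : {linear H -> H}) : Prop :=
  forall v, 0 <= dot (A v) v.

Definition le_op (A B : {linear H -> H}) : Prop :=
  forall v, 0 <= dot (B v - A v) v.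

(* T is total; its values outside the achronal Borel sets are irrelevant.
   The series of operators converges in the strong operator topology, which
   amounts to weak convergence since its terms are nonnegative. *)
Record achronal_localization (T : set 'rV[R]_4 -> {linear H -> H}) : Prop := {
  al_bounded : forall D, borel_achronal D -> bounded_op (T D);
  al_nonneg : forall D, borel_achronal D -> nonneg_op (T D);
  al_set0 : forall v, T set0 v = 0;
  al_sum : forall D : nat -> set 'rV[R]_4,
    (forall n, borel_achronal (D n)) ->
    trivIset [set: nat] D ->
    maximal_achronal (\bigcup_n D n) ->
    forall v, series (fun n => T (D n) v) @ \oo --> v }.

Variable T : set 'rV[R]_4 -> {linear H -> H}.

Definition sandwiched (Y B C : set 'rV[R]_4) : Prop :=
  [/\ borel_achronal B, borel_achronal C, B `<=` Y, Y `<=` C &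
      forall v, T (C `\` B) v = 0].

Definition T_measurable (Y : set 'rV[R]_4) : Prop :=
  exists B C, sandwiched Y B C.

(* The extension of T to the T-measurable sets Y: the value at some inner set
   B of Y, all choices of B giving the same operator. *)
Definition T_ext (Y : set 'rV[R]_4) : {linear H -> H} :=
  T (xget set0 [set B | exists C, sandwiched Y B C]).

End Localization.

(* Main.v *)
(* (b) If Delta is achronal, no point of Delta is causally related to a point
   of Sigma outside Delta_Sigma, so Delta and Sigma \ Delta_Sigma lie in a
   common maximal achronal set; additivity there and on Sigma gives
   T(Delta) <= I - T(Sigma \ Delta_Sigma) = T(Delta_Sigma).

   (a) Marczewski's argument for the Suslin operation, applied to the sigma-ideal
   of T-null Borel subsets of Sigma.  Write Delta = f(P) and cut P into nested
   cells of vanishing diameter indexed by finite sequences.  The regions of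
   influence E_s of the cells have Borel hulls M_s inside the closure of E_s,
   minimal modulo T-null sets (this is where separability of the Hilbert space
   enters), so that M_s minus the union of the M_(i::s) is T-null.  A point of
   M_[] outside these countably many gaps lies on a branch of the M_s;
   completeness of P gives a point p in the limit of the cells, and continuity
   shows that x is causally related to f(p).  Hence M_[] differs from Delta_Sigma
   by a T-null set. *)
Require Import Defs.
From mathcomp Require Import all_boot all_order all_algebra.
From mathcomp Require Import all_classical all_reals all_analysis.
From mathcomp Require Import ring lra.

Set Implicit Arguments.
Unset Strict Implicit.
Unset Printing Implicit Defensive.

Import Order.TTheory GRing.Theory Num.Theory.

Local Open Scope classical_set_scope.
Local Open Scope ring_scope.
Local Open Scope complex_scope.

(** * Borel sets and achronal sets in Minkowski space *)

Section Geometry.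
Variable R : realType.
Implicit Types (x y z : 'rV[R]_4) (D E S : set 'rV[R]_4).

Local Notation borel := <<s [set U : set 'rV[R]_4 | open U] >>.
Local Notation borelType := (g_sigma_algebraType [set U : set 'rV[R]_4 | open U]).

Lemma borelD D E : borel D -> borel E -> borel (D `\` E).
Proof. exact: (@measurableD _ borelType). Qed.

Lemma borelI D E : borel D -> borel E -> borel (D `&` E).
Proof. exact: (@measurableI _ borelType). Qed.

Lemma borelU D E : borel D -> borel E -> borel (D `|` E).
Proof. exact: (@measurableU _ borelType). Qed.

Lemma borel_bigcup (F : nat -> set 'rV[R]_4) :
  (forall n, borel (F n)) -> borel (\bigcup_n F n).
Proof. by move=> mF; apply: (@bigcupT_measurable _ borelType). Qed.

Lemma borel_bigcap (F : nat -> set 'rV[R]_4) :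
  (forall n, borel (F n)) -> borel (\bigcap_n F n).
Proof. by move=> mF; apply: (@bigcapT_measurable _ borelType). Qed.

Lemma closed_borel D : closed D -> borel D.
Proof.
move=> cD; rewrite -[D]setCK; apply: sigma_algebraC.
by apply: sub_sigma_algebra => /=; rewrite openC.
Qed.

Lemma minksq_continuous : continuous (@minksq R).
Proof.
have c i : continuous (fun a : 'rV[R]_4 => a 0 i * a 0 i).
  move=> x; have ci := @coord_continuous R 1 4 0 i x.
  exact: (@continuousM _ _ (fun a : 'rV[R]_4 => a 0 i) _ x ci ci).
by move=> x; exact: continuousB (continuousB (continuousB (c 0 x) (c 1 x)) (c 2 x)) (c 3 x).
Qed.

Lemma minksqN x : minksq (- x) = minksq x.
Proof. by rewrite /minksq /mink !mxE; ring. Qed.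

Lemma minksqBC x y : minksq (x - y) = minksq (y - x).
Proof. by rewrite -minksqN opprB. Qed.

Lemma minksq_sub_continuous :
  continuous (fun p : 'rV[R]_4 * 'rV[R]_4 => minksq (p.1 - p.2)).
Proof.
move=> p; have h : {for p, continuous (fun p : 'rV[R]_4 * 'rV[R]_4 => p.1 - p.2)}.
  by apply: (@continuousB _ _ _ fst snd); [exact: cvg_fst|exact: cvg_snd].
exact: continuous_comp h (@minksq_continuous _).
Qed.

Lemma achronalS D E : D `<=` E -> achronal E -> achronal D.
Proof. by move=> DE aE x y /DE Ex /DE Ey; exact: aE. Qed.

Lemma achronalU D E : achronal D -> achronal E ->
  (forall x y, D x -> E y -> minksq (x - y) <= 0) -> achronal (D `|` E).
Proof.
move=> aD aE DE x y [Dx|Ex] [Dy|Ey]; [exact: aD|exact: DE| |exact: aE].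
by rewrite minksqBC; exact: DE.
Qed.

(** With one point fixed, the condition [minksq (x - y) <= 0] is closed in the other, so the two
    points can be moved into the closure one after the other. *)
Lemma achronal_closure D : achronal D -> achronal (closure D).
Proof.
move=> aD; have cl y : closed [set x | minksq (x - y) <= 0].
  apply: (@closed_comp _ _ (fun x => minksq (x - y)) [set r | r <= 0]); last exact: closed_le.
  move=> x _; have h : {for x, continuous (fun x : 'rV[R]_4 => x - y)}.
    by apply: (@continuousB _ _ _ id (cst y)); [exact: cvg_id|exact: cst_continuous].
  exact: continuous_comp h (@minksq_continuous _).
have sub S : closed S -> D `<=` S -> closure D `<=` S.
  by move=> /closure_id {2}-> ?; exact: closureS.
have half x y : closure D x -> D y -> minksq (x - y) <= 0.
  by move=> Dx Dy; apply: (sub _ (cl y)) Dx => z Dz; exact: aD.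
move=> x y Dx Dy; rewrite minksqBC; apply: (sub _ (cl x)) Dy => z Dz /=.
by rewrite minksqBC; exact: half.
Qed.

Lemma maximal_achronal_closed D : maximal_achronal D -> closed D.
Proof.
move=> [aD mD]; apply/closure_id/esym/mD; first exact: achronal_closure.
exact: subset_closure.
Qed.

Lemma maximal_achronal_borel D : maximal_achronal D -> borel_achronal D.
Proof.
move=> mD; split; last by case: mD.
by apply: closed_borel; exact: maximal_achronal_closed.
Qed.

Lemma borel_achronalS D E : borel D -> D `<=` E -> borel_achronal E -> borel_achronal D.
Proof. by move=> mD DE [_ aE]; split => //; exact: achronalS aE. Qed.

(** Zorn's lemma is applied to the sets whose union with [D] is achronal, rather than to the
    achronal supersets of [D]: this family also contains the union of the empty chain. *)
Lemma achronal_maximal_extension D : achronal D ->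
  exists2 E, maximal_achronal E & D `<=` E.
Proof.
move=> aD; pose P E := achronal (E `|` D).
have [F FP totF|A [PA maxA]] := @Zorn_bigcup _ P.
  have FD E : F E -> P E by exact: FP.
  move=> x y [[A FA Ax]|Dx] [[B FB By]|Dy]; last exact: aD.
  - have [AB|BA] := totF _ _ FA FB.
      by apply: (FD _ FB); left => //; exact: AB.
    by apply: (FD _ FA); left => //; exact: BA.
  - by apply: (FD _ FA); [left|right].
  - by apply: (FD _ FB); [right|left].
exists (A `|` D); last exact: subsetUr.
split=> // E aE ADE; apply/seteqP; split => //; left; apply: contrapT => nAx.
have PE : P E by rewrite /P (_ : E `|` D = E) // setUidl// => y Dy; apply: ADE; right.
apply: (maxA E) PE; split; last by move=> /(_ _ H)/nAx.
by move=> y Ay; apply: ADE; left.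
Qed.

(** The line in time direction through a point [x] of an achronal extension meets [S] in
    [x + t *: e]. Both points lie in the extension, so [t ^+ 2 <= 0], and [x] is itself the point of
    [S]. *)
Lemma causal_base_maximal_achronal S : causal_base S -> maximal_achronal S.
Proof.
move=> [sS mS]; split.
  move=> x y Sx Sy; have [->|/eqP xy] := eqVneq x y; last exact/ltW/sS.
  by rewrite subrr /minksq /mink !mxE; lra.
move=> E aE SE; apply/seteqP; split => // x Ex.
pose e : 'rV[R]_4 := delta_mx 0 0.
have e1 : minksq e = 1 by rewrite /minksq /mink !mxE /=; lra.
have [|s [Ss [t _ xts]]] := mS [set x + t *: e | t in [set: R]].
  exists x, e; split=> //; last by rewrite e1.
  by move=> e0; move: e1; rewrite e0 /minksq /mink !mxE; lra.
have := aE _ _ (SE _ Ss) Ex; rewrite -xts addrAC subrr add0r.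
have -> : minksq (t *: e) = t ^+ 2 * minksq e.
  by rewrite /minksq /mink !mxE; ring.
rewrite e1 mulr1 => t2; move: xts.
have /eqP -> : t == 0 by rewrite -sqrf_eq0 eq_le t2 sqr_ge0.
by rewrite scale0r addr0 => ->.
Qed.

End Geometry.

(** * Quadratic forms of operators on a complex Hilbert space *)

Section HilbertOperators.
Variables (R : realType) (H : completeNormedModType R[i]).
Variable dot : {dot H for Num.conj}.
Hypothesis H_hilbert : inner_product_norm dot.

(** Polarization: testing the form at [v + w] and [v + 'i *: w] with [w = A v] makes both the sum
    and the difference of the two cross terms vanish, hence [dot w w = 0]. *)
Lemma quad_eq0 (A : {linear H -> H}) :
  (forall v, dot (A v) v = 0) -> forall v, A v = 0.
Proof.
move=> A0 v; set w := A v.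
have sw : dot (A v) w + dot (A w) v = 0.
  by have := A0 (v + w); rewrite linearD linearDl !linearDr /= !A0 addr0 add0r.
have dw : dot (A v) w = dot (A w) v.
  have := A0 (v + 'i%R *: w); rewrite linearD linearZ linearDl !linearDr /=.
  rewrite !linearZl_LR !linearZr_LR /= !A0 !mulr0 scaler0 addr0 add0r conjCi mulNr.
  move/eqP; rewrite addrC subr_eq0 => /eqP iw.
  exact/esym/(mulfI (neq0Ci R[i])).
have : dot w w = 0.
  by move: sw; rewrite -dw -mulr2n => /eqP; rewrite mulrn_eq0 /= => /eqP.
by rewrite -H_hilbert => /eqP; rewrite sqrf_eq0 normr_eq0 => /eqP.
Qed.

(** The bound by the identity makes the quadratic form continuous, so that its zeros on a dense set
    spread to all of [H]. *)
Lemma contraction_dense_eq0 (A : {linear H -> H}) (D : set H) :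
  nonneg_op dot A -> (forall v, dot (A v) v <= dot v v) ->
  dense D -> (forall v, D v -> dot (A v) v = 0) -> forall v, A v = 0.
Proof.
move=> A_ge0 A_le1 dD AD0; apply: quad_eq0 => v; apply/eqP.
rewrite eq_le A_ge0 andbT; apply/contraT => Q_gt0.
set q := dot (A v) v in Q_gt0 *.
have q0 : 0 < q by rewrite lt_def A_ge0 andbT; apply: contra Q_gt0 => /eqP->.
(* With this radius the estimate below reads [q <= 2 * |v - u| ^+ 2 < q / 2], which contradicts
   [0 < q]. *)
have e0 : 0 < sqrtC (q / 4) by rewrite sqrtC_gt0 divr_gt0.
have [|u [vu Du]] := dD _ _ (open_interior (ball v (sqrtC (q / 4)))).
  by exists v; apply: nbhsx_ballx.
have {}vu : `|v - u| ^+ 2 < q / 4.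
  have := interior_subset vu; rewrite -ball_normE /= => vu'.
  by rewrite -[ltRHS](sqrtCK (q / 4)) ltr_pXn2r ?nnegrE// ltW.
(* the parallelogram law for the semidefinite form of [A] *)
have : dot (A v) v <= 2 * dot (A (v - u)) (v - u) + 2 * dot (A u) u.
  rewrite -subr_ge0; apply: le_trans (A_ge0 (v - u - u)) _.
  rewrite !(linearB A) !linearBl /= !linearBr /= le_eqVlt; apply/orP; left.
  by apply/eqP; ring.
rewrite (AD0 u Du) mulr0 addr0 -/q => /le_trans/(_ (ler_wpM2l _ (A_le1 _))).
rewrite -H_hilbert => /(_ (ler0n _ _)) h.
have : q < 2 * (q / 4) by apply: le_lt_trans h _; rewrite ltr_pM2l.
have -> : 2 * (q / 4) = q / 2 by field.
rewrite ltr_pdivlMr// -subr_lt0 mulr_natr mulr2n addrK => q_lt0.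
by have := lt_trans q0 q_lt0; rewrite ltxx.
Qed.

End HilbertOperators.

(** * Additivity, null sets and measurable hulls of an achronal localization *)

Section AchronalLocalization.
Variables (R : realType) (H : completeNormedModType R[i]).
Variable dot : {dot H for Num.conj}.
Hypothesis H_hilbert : inner_product_norm dot.
Variable T : set 'rV[R]_4 -> {linear H -> H}.
Hypothesis T_AL : achronal_localization dot T.
Implicit Types (A B C S : set 'rV[R]_4) (v : H).

Local Notation borel := <<s [set U : set 'rV[R]_4 | open U] >>.
Local Notation borelType := (g_sigma_algebraType [set U : set 'rV[R]_4 | open U]).

Definition T_negligible A := forall v, T A v = 0.

Lemma borel_achronal0 : borel_achronal (@set0 'rV[R]_4).
Proof. by split=> //; exact: sigma_algebra0. Qed.

(** The three sets are padded with empty sets to a sequence; its partial sums are constant from the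
    third on. *)
Lemma al_sum3 A B C v :
  borel_achronal A -> borel_achronal B -> borel_achronal C ->
  A `&` B = set0 -> A `&` C = set0 -> B `&` C = set0 ->
  maximal_achronal (A `|` B `|` C) -> T A v + T B v + T C v = v.
Proof.
move=> bA bB bC AB AC BC mABC; pose D n := nth set0 [:: A; B; C] n.
have bD n : borel_achronal (D n).
  by case: n => [|[|[|n]]] //=; rewrite /D /= nth_nil; exact: borel_achronal0.
have tD : trivIset [set: nat] D.
  apply/trivIsetP => i j _ _; rewrite /D.
  by case: i => [|[|[|i]]]; case: j => [|[|[|j]]] //=;
    rewrite ?nth_nil ?setI0 ?set0I// setIC.
have UD : \bigcup_n D n = A `|` B `|` C.
  apply/seteqP; split => x; last first.
    by case=> [[Ax|Bx]|Cx]; [exists 0%N|exists 1%N|exists 2%N].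
  by case=> -[|[|[|n]]] _; rewrite /D /= ?nth_nil//; [left; left|left; right|right].
have := al_sum T_AL bD tD; rewrite UD => /(_ mABC v).
rewrite -(cvg_shiftn 3) (_ : [sequence _]_n = cst (T A v + T B v + T C v)).
  by move=> cv; apply: (cvg_unique (@norm_hausdorff _ H) _ cv); exact: cvg_cst.
apply/funext => n /=; rewrite /series /=; elim: n => [|n IH].
  by rewrite !big_nat_recr// big_geq//= add0r.
by rewrite addSn big_nat_recr//= IH /D addn3 /= nth_nil (al_set0 T_AL) addr0.
Qed.

Lemma al_complement A S v :
  maximal_achronal S -> borel A -> A `<=` S -> T A v + T (S `\` A) v = v.
Proof.
move=> mS mA AS; have [mS' aS] := maximal_achronal_borel mS.
rewrite -[LHS]addr0 -(al_set0 T_AL v).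
apply: al_sum3; rewrite ?setI0//.
- exact: borel_achronalS AS _.
- by apply: (@borel_achronalS _ _ S) => //; exact: borelD.
- exact: borel_achronal0.
- by rewrite setIDA setIC -setIDA setDv setI0.
- by rewrite setU0 setDUK.
Qed.

(** Normalization is given only on maximal achronal sets, so the union is embedded in such a set
    [S], and the splittings of [S] into two and into three pieces are compared. *)
Lemma al_setU A B v : borel A -> borel B -> achronal (A `|` B) ->
  A `&` B = set0 -> T (A `|` B) v = T A v + T B v.
Proof.
move=> mA mB aAB AB; have mU := borelU mA mB.
have [S mS US] := achronal_maximal_extension aAB.
have [mS' aS] := maximal_achronal_borel mS.
apply: (addIr (T (S `\` (A `|` B)) v)); rewrite al_complement//.
apply/esym/al_sum3 => //.
- by apply: borel_achronalS (conj mU aAB); last exact: subsetUl.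
- by apply: borel_achronalS (conj mU aAB); last exact: subsetUr.
- by apply: (@borel_achronalS _ _ S) => //; exact: borelD.
- by apply/seteqP; split => // x [Ax [_ nx]]; apply: nx; left.
- by apply/seteqP; split => // x [Bx [_ nx]]; apply: nx; right.
- by rewrite setDUK.
Qed.

Lemma al_setD A B v : borel_achronal B -> borel A -> A `<=` B ->
  T B v = T A v + T (B `\` A) v.
Proof.
move=> [mB aB] mA AB; rewrite -{1}(setDUK AB); apply: al_setU => //.
- exact: borelD.
- by rewrite setDUK.
- by rewrite setIDA setIC -setIDA setDv setI0.
Qed.

Lemma al_le A B v : borel_achronal B -> borel A -> A `<=` B ->
  dot (T A v) v <= dot (T B v) v.
Proof.
move=> bB mA AB; rewrite (al_setD v bB mA AB) linearDl lerDl.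
apply: (al_nonneg T_AL); apply: (@borel_achronalS _ _ B) => //.
by case: bB => mB _; exact: borelD.
Qed.

Lemma al_le1 A v : borel_achronal A -> dot (T A v) v <= dot v v.
Proof.
move=> [mA aA]; have [S mS AS] := achronal_maximal_extension aA.
have bS := maximal_achronal_borel mS.
rewrite -[X in _ <= dot X _](al_complement v mS mA AS) linearDl lerDl.
apply: (al_nonneg T_AL); apply: (@borel_achronalS _ _ S) => //.
by case: bS => mS' _; exact: borelD.
Qed.

Lemma T_negligibleS A B : borel_achronal B -> borel A -> A `<=` B ->
  T_negligible B -> T_negligible A.
Proof.
move=> bB mA AB B0; apply: (quad_eq0 H_hilbert) => v; apply/eqP.
rewrite eq_le (al_nonneg T_AL (borel_achronalS mA AB bB)) andbT.
by apply: le_trans (al_le v bB mA AB) _; rewrite B0 linear0l.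
Qed.

(** The sets are made disjoint and preceded by the complement of their union in [S]. All nonempty
    partial sums then equal the value at this complement, which is therefore the identity and leaves
    zero for the union. *)
Lemma T_negligible_bigcup S (F : nat -> set 'rV[R]_4) : maximal_achronal S ->
  (forall n, borel (F n)) -> (forall n, F n `<=` S) ->
  (forall n, T_negligible (F n)) -> T_negligible (\bigcup_n F n).
Proof.
move=> mS mF FS F0 v; have bS := maximal_achronal_borel mS.
have bF n : borel_achronal (F n) by apply: borel_achronalS bS.
have mU := borel_bigcup mF; have US : \bigcup_n F n `<=` S by apply: bigcup_sub.
pose D n := if n is n'.+1 then seqDU F n' else S `\` \bigcup_n F n.
have mDU n : borel (seqDU F n).
  apply: borelD => //.
  by apply: (@bigsetU_measurable _ borelType) => i _; exact: mF.
have bD n : borel_achronal (D n).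
  apply: (@borel_achronalS _ _ S) => //; case: n => [|n] /=.
  - by apply: borelD => //; case: bS.
  - exact: mDU.
  - exact: subDsetl.
  - by move=> x [/FS].
have tD : trivIset [set: nat] D.
  apply/trivIsetP => -[|i] [|j] _ _ //= ij.
  - apply/seteqP; split => // x [[_ nx]]; rewrite seqDU_bigcup_eq in nx.
    by move=> Fx; apply: nx; exists j.
  - apply/seteqP; split => // x [Fx [_]]; rewrite seqDU_bigcup_eq.
    by apply; exists i.
  - by have /trivIsetP := trivIset_seqDU F; apply.
have UD : \bigcup_n D n = S.
  apply/seteqP; split => x.
    by case=> -[|n] _ /=; [case|case=> /FS].
  move=> Sx; have [|nx] := pselect ((\bigcup_n F n) x).
    by rewrite seqDU_bigcup_eq => -[n _ Fx]; exists n.+1.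
  by exists 0%N.
have := al_sum T_AL bD tD; rewrite UD => /(_ mS v).
rewrite -(cvg_shiftn 1) (_ : [sequence _]_n = cst (T (S `\` \bigcup_n F n) v)).
  move=> cv; have e : T (S `\` \bigcup_n F n) v = v.
    by apply: (cvg_unique (@norm_hausdorff _ H) _ cv); exact: cvg_cst.
  by have := al_complement v mS mU US; rewrite e => /(canRL (addrK _)); rewrite subrr.
apply/funext => n /=; rewrite /series /=; elim: n => [|n IH].
  by rewrite big_nat_recr// big_geq//= add0r.
have D0 : T_negligible (seqDU F n).
  by apply: (T_negligibleS (bF n)) => //; exact: subDsetl.
by rewrite addSn big_nat_recr//= IH addn1 /= D0 addr0.
Qed.

(** Marczewski's measurable hull: a Borel superset of [E] in [S], minimal modulo null sets. *)
Definition hull S E M :=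
  [/\ borel M, E `<=` M, M `<=` S &
      forall N, borel N -> E `<=` N -> T_negligible (M `\` N)].

(** For a single vector [v] minimality is a matter of one real number: the infimum of [q] over the
    Borel supersets of [E] in [S] is attained by intersecting a minimizing sequence. *)
Lemma weak_hull_exists S E v : maximal_achronal S -> E `<=` S ->
  exists M, [/\ borel M, E `<=` M, M `<=` S &
    forall N, borel N -> E `<=` N -> dot (T (M `\` N) v) v = 0].
Proof.
move=> mS ES; have bS := maximal_achronal_borel mS.
pose outer := [set M | [/\ borel M, E `<=` M & M `<=` S]].
pose q M := complex.Re (dot (T M v) v).
have bo M : outer M -> borel_achronal M.
  by case=> mM _ MS; exact: borel_achronalS bS.
have qE M : borel_achronal M -> dot (T M v) v = (q M)%:C.
  move=> bM; have := al_nonneg T_AL bM v; rewrite /q.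
  by case: (dot _ _) => a b; rewrite lecE /= => /andP[/eqP -> _].
have oS : outer S by split => //; case: bS.
have lb : has_lbound (q @` outer).
  exists 0 => _ [M oM <-]; have := al_nonneg T_AL (bo _ oM) v.
  by rewrite qE ?lecR//; exact: bo.
have hi : has_inf (q @` outer) by split=> //; exists (q S), S.
have /choice[M_ M_P] (n : nat) : exists M, outer M /\ q M < inf (q @` outer) + n.+1%:R^-1.
  have [|_ [M oM <-] qM] := @inf_adherent _ _ n.+1%:R^-1 _ hi; first by rewrite invr_gt0.
  by exists M.
exists (\bigcap_n M_ n); set M := \bigcap_n M_ n.
have oM : outer M.
  split.
  - by apply: borel_bigcap => n; case: (M_P n) => -[].
  - by move=> x Ex n _; case: (M_P n) => -[_ /(_ _ Ex)].
  - by move=> x /(_ 0%N I); case: (M_P 0%N) => -[_ _ MS] _ /MS.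
have bM := bo _ oM.
have qM : q M <= inf (q @` outer).
  rewrite leNgt; apply/negP => /ltr_add_invr[n]; apply/negP; rewrite -leNgt.
  case: (M_P n) => on /ltW; apply: le_trans.
  rewrite -lecR -!qE//; last exact: bo.
  by apply: al_le (bo _ on) _ _; [case: oM|exact: bigcap_inf].
have [mM EM MS] := oM; split=> // N mN EN.
have mMN := borelI mM mN.
have oMN : outer (M `&` N).
  by split=> //; [move=> x Ex; split; [exact: EM|exact: EN]|move=> x [/MS]].
have bMN := bo _ oMN.
have bD : borel_achronal (M `\` N).
  by apply: borel_achronalS bM; [exact: borelD|exact: subDsetl].
apply/eqP; rewrite eq_le (al_nonneg T_AL bD) andbT.
(* The set [M] intersected with [N] competes for the infimum, so the remaining summand has a form at
   most 0 at [v]. *)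
have := al_setD v bM mMN (@subIsetl _ _ _); rewrite setDIr setDv set0U => e.
have : dot (T M v) v <= dot (T (M `&` N) v) v.
  by rewrite !qE// lecR; apply: le_trans qM _; apply: ge_inf => //; exists (M `&` N).
by rewrite e linearDl /= gerDl.
Qed.

Hypothesis H_separable : separable H.

(** The weak hulls for a dense sequence of vectors are intersected; a difference [M \ N] then has a
    form vanishing on a dense set, hence everywhere. *)
Lemma hull_exists S E : maximal_achronal S -> E `<=` S -> exists M, hull S E M.
Proof.
move=> mS ES; have bS := maximal_achronal_borel mS.
have [D cD dD] := H_separable.
have [u uD] : exists u : nat -> H, D `<=` range u.
  have /pfcard_geP[D0|[u]] := cD; first by exists (fun=> 0); rewrite D0.
  by exists u => x /(@surj _ _ _ _ u)[n _ <-]; exists n.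
have /choice[M_ M_P] (n : nat) := weak_hull_exists (u n) mS ES.
exists (\bigcap_n M_ n); set M := \bigcap_n M_ n.
have mM : borel M by apply: borel_bigcap => n; case: (M_P n).
have MS : M `<=` S by move=> x /(_ 0%N I); case: (M_P 0%N) => _ _ MS _ /MS.
split=> //; first by move=> x Ex n _; case: (M_P n) => _ /(_ _ Ex).
move=> N mN EN.
have bMN : borel_achronal (M `\` N).
  by apply: borel_achronalS bS; [exact: borelD|move=> x [/MS]].
apply: (contraction_dense_eq0 H_hilbert (al_nonneg T_AL bMN) _ dD).
  by move=> v; exact: al_le1.
move=> v /uD[n _ <-]; case: (M_P n) => mn En nS /(_ _ mN EN) n0.
apply/eqP; rewrite eq_le (al_nonneg T_AL bMN) andbT -n0.
apply: al_le; [|by case: bMN|by move=> x [Mx Nx]; split => //; exact: Mx].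
by apply: borel_achronalS bS; [exact: borelD|move=> x [/nS]].
Qed.

End AchronalLocalization.

(** * Nested cells of vanishing diameter in a complete separable space *)

Section Cells.
Variables (R : realType) (P : completePseudoMetricType R) (d : nat -> P).

(* Sequences are extended at their head: [i :: s] indexes a subcell of [s]. *)
Fixpoint cell (s : seq nat) : set P :=
  if s is i :: s' then cell s' `&` ball (d i) (size s)%:R^-1 else setT.

Fixpoint prefix_of (b : nat -> nat) n : seq nat :=
  if n is n'.+1 then b n' :: prefix_of b n' else [::].

Lemma size_prefix_of b n : size (prefix_of b n) = n.
Proof. by elim: n => //= n ->. Qed.

Lemma cell_prefixS b m n : (m <= n)%N ->
  cell (prefix_of b n) `<=` cell (prefix_of b m).
Proof.
elim: n => [|n IH]; first by rewrite leqn0 => /eqP ->.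
by rewrite leq_eqVlt => /orP[/eqP -> //|/IH mn] x [/mn].
Qed.

Lemma cell_cover s p : dense (range d) -> cell s p -> exists i, cell (i :: s) p.
Proof.
move=> dd sp; pose e : R := (size s).+1%:R^-1; have e0 : 0 < e by rewrite invr_gt0.
have [|y [/interior_subset py [i _ diy]]] := dd _ _ (open_interior (ball p e)).
  by exists p; exact: nbhsx_ballx.
by exists i; split => //; apply: ball_sym; rewrite diy.
Qed.

(** Nonempty cells along a branch generate a proper filter. It is Cauchy, since the cell of length
    [n.+1] lies in a ball of radius [n.+1%:R^-1]. The limit [p] need not belong to the cells. *)
Lemma cell_cvg b : (forall n, cell (prefix_of b n) !=set0) ->
  exists p : P, forall U, nbhs p U -> exists n, cell (prefix_of b n) `<=` U.
Proof.
move=> ne; pose F : set_system P := filter_from setT (fun n => cell (prefix_of b n)).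
have FF : ProperFilter F.
  apply: filter_from_proper; last by move=> n _; exact: ne.
  apply: filter_from_filter; first by exists 0%N.
  move=> m n _ _; exists (maxn m n) => // x bx.
  by split; apply: cell_prefixS bx; rewrite (leq_maxl, leq_maxr).
have /cauchy_cvg/cvg_ex[p Fp] : cauchy F.
  apply: cauchy_exP => e e0.
  have [n] := ltr_add_invr e0; rewrite add0r => ne'.
  exists (d (b n)), n.+1 => // x [_]; rewrite /= size_prefix_of.
  exact/le_ball/ltW.
by exists p => U /Fp[n _ nU]; exists n.
Qed.

End Cells.

(** * Measurability of the region of influence and the causality condition *)

Section Causality.
Variables (R : realType) (H : completeNormedModType R[i]).
Variable dot : {dot H for Num.conj}.
Hypothesis H_hilbert : inner_product_norm dot.
Variable T : set 'rV[R]_4 -> {linear H -> H}.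
Hypothesis T_AL : achronal_localization dot T.
Implicit Types (D S : set 'rV[R]_4).

Local Notation borel := <<s [set U : set 'rV[R]_4 | open U] >>.

Lemma T_measurable_set0 : T_measurable T set0.
Proof.
exists set0, set0; split; rewrite ?setD0//; try exact: borel_achronal0.
exact: al_set0 T_AL.
Qed.

Lemma region_of_influence_measurable D S : separable H ->
  maximal_achronal S -> suslin D -> T_measurable T (region_of_influence D S).
Proof.
move=> sH mS [->|[P [f [_ [Q cQ dQ] cf <-]]]].
  rewrite (_ : region_of_influence _ _ = set0); first exact: T_measurable_set0.
  by apply/seteqP; split => // x [_ []].
have [d dd] : exists d : nat -> P, dense (range d).
  have /pfcard_geP[Q0|[u]] := cQ.
    (* An empty dense set is excluded because [P] is pointed. *)
    have [|p []] := dQ setT _ openT; first by exists point.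
    by rewrite Q0.
  exists u => O O0 oO; have [p [Op Qp]] := dQ O O0 oO; exists p; split => //.
  by have [n _ <-] := @surj _ _ _ _ u _ Qp; exists n.
have bS := maximal_achronal_borel mS.
pose E s := [set x | S x /\ exists2 p, cell d s p & 0 <= minksq (x - f p)].
have ES s : E s `<=` S by move=> x [].
have E0 : E [::] = region_of_influence (range f) S.
  apply/seteqP; split => x [Sx [z]].
    by move=> _ xz; split => //; exists (f z) => //; exists z.
  by move=> [p _ <-] xp; split => //; exists p.
have Ecover s : E s `<=` \bigcup_i E (i :: s).
  move=> x [Sx [p sp xp]]; have [i ip] := cell_cover dd sp.
  by exists i => //; split => //; exists p.
have bcl s : borel (closure (E s)) by apply: closed_borel; exact: closed_closure.
have /choice[M M_P] s : exists M, hull T S (E s) M /\ M `<=` closure (E s).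
  have [M [mM EM MS hM]] := hull_exists H_hilbert T_AL sH mS (@ES s).
  (* Cutting down by the closed set keeps the hull minimal and makes every point of [M s] a limit of
     points of [E s]. *)
  exists (M `&` closure (E s)); split; last exact: subIsetr.
  split; [exact: borelI| |by move=> x [/MS]|].
    by move=> x Ex; split; [exact: EM|exact: subset_closure].
  move=> N mN EN. apply: (T_negligibleS H_hilbert T_AL _ _ _ (hM _ mN EN)).
  - by apply: borel_achronalS bS; [exact: borelD|move=> x [/MS]].
  - by apply: borelD => //; exact: borelI.
  - by move=> x [[]].
have mM s : borel (M s) by case: (M_P s) => -[].
have EM s : E s `<=` M s by case: (M_P s) => -[].
have MS s : M s `<=` S by case: (M_P s) => -[].
have Mcl s : M s `<=` closure (E s) by case: (M_P s).
pose gap s := M s `\` \bigcup_i M (i :: s).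
have mgap s : borel (gap s) by apply: borelD => //; exact: borel_bigcup.
have gap0 s : T_negligible T (gap s).
  case: (M_P s) => -[_ _ _ hM] _; apply: hM; first exact: borel_bigcup.
  by move=> x /Ecover[i _ /EM]; exists i.
(* Finite sequences are countable, so the gaps can be listed by their codes, with the empty set at
   numbers that code nothing. *)
pose gapn n := if unpickle n is Some s then gap s else set0.
pose Z := \bigcup_n gapn n.
have mgapn n : borel (gapn n).
  by rewrite /gapn; case: (unpickle n) => [s|]; [exact: mgap|exact: sigma_algebra0].
have Z0 : T_negligible T Z.
  apply: (T_negligible_bigcup H_hilbert T_AL mS) => // n; rewrite /gapn.
    by case: (unpickle n) => // s x [/MS].
  by case: (unpickle n) => [s|]; [exact: gap0|exact: al_set0 T_AL].
have mZ : borel Z by exact: borel_bigcup.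
have ZS : Z `<=` S.
  by move=> x [n _]; rewrite /gapn; case: (unpickle n) => // s [/MS].
have inZ s x : gap s x -> Z x by exists (pickle s) => //; rewrite /gapn pickleK.
exists (M [::] `\` Z), (M [::]); split.
- by apply: borel_achronalS bS; [exact: borelD|move=> x [/MS]].
- exact: borel_achronalS bS.
- move=> x [Mx nZx].
  (* Outside the gaps a point of [M s] lies in some [M (i :: s)]; iterating this choice from [[::]]
     yields the branch [b]. The index 0 is a default where [x] is not in [M s]. *)
  have /choice[g g_P] s : exists i, M s x -> M (i :: s) x.
    have [Msx|] := pselect (M s x); last by exists 0%N.
    have [[i _ ?]|nM] := pselect ((\bigcup_i M (i :: s)) x); first by exists i.
    by case: nZx; exact: (inZ s).
  pose br n := iter n (fun s => g s :: s) [::]; pose b n := g (br n).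
  have brE n : br n = prefix_of b n by elim: n => //= n <-.
  have Mb n : M (prefix_of b n) x by rewrite -brE; elim: n => //= n; exact: g_P.
  have [|p p_cvg] := @cell_cvg R P d b.
    move=> n; have [y [[_ [p bp _]] _]] := Mcl _ _ (Mb n) _ filterT.
    by exists p.
  rewrite -E0; split; first exact: MS Mx.
  (* If [x] and [f p] were spacelike separated, so would be all pairs near them. But [x] is a limit
     of points of [E (prefix_of b n)], each causally related to the image of a point of the cell,
     and these images are near [f p] for some [n]. *)
  exists p => //; rewrite leNgt; apply/negP => xp_lt0.
  have /= : \forall q \near (x, f p), minksq (q.1 - q.2) < 0.
    exact: (@minksq_sub_continuous R (x, f p) _ (lt_nbhsl xp_lt0)).
  move=> [[U V] /= [Ux Vp] UV].
  have [n nV] := p_cvg _ (cf p _ Vp).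
  have [y [[_ [q bq yq]] Uy]] := Mcl _ _ (Mb n) _ Ux.
  have := UV (y, f q) (conj Uy (nV _ bq)).
  by rewrite /= ltNge yq.
- by rewrite -E0; exact: EM.
- apply: (T_negligibleS H_hilbert T_AL _ _ _ Z0).
  + exact: borel_achronalS bS.
  + by apply: borelD => //; exact: borelD.
  + by move=> x [Mx nMZ]; apply: contrapT => nZ; apply: nMZ.
Qed.

(** Gives access to [T_ext] through whichever inner set [xget] picks; the causality inequality is
    then proved for arbitrary sandwiches. *)
Lemma T_ext_sandwiched Y : T_measurable T Y ->
  exists B C, sandwiched T Y B C /\ T_ext T Y = T B.
Proof.
move=> [B [C BC]]; rewrite /T_ext; set W := [set _ | _].
have [C' WC'] : W (xget set0 W) by apply: xgetPex; exists B, C.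
by exists (xget set0 W), C'.
Qed.

Lemma causality D S : maximal_achronal S -> achronal D ->
  T_measurable T D -> T_measurable T (region_of_influence D S) ->
  le_op dot (T_ext T D) (T_ext T (region_of_influence D S)).
Proof.
move=> mS aD /T_ext_sandwiched[B [_ [[bB _ BD _ _] ->]]].
move=> /T_ext_sandwiched[B' [C [[bB' bC B'D DC CB0] ->]]] v.
have bS := maximal_achronal_borel mS; have [mS' aS] := bS.
have [mB _] := bB; have [mB' _] := bB'; have [mC _] := bC.
have mCS := borelI mS' mC; have mSC := borelD mS' mC.
have B'CS : B' `<=` S `&` C.
  by move=> x /[dup] /B'D [Sx _] B'x; split => //; exact/DC/B'D.
(* The region of influence need not be Borel, so the part of its outer set [C] in [S] replaces it;
   this part differs from [B'] by a subset of the null set [C \ B']. *)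
have TB' : T (S `&` C) v = T B' v.
  rewrite (al_setD T_AL v _ mB' B'CS); last first.
    by apply: borel_achronalS bS => //; exact: subIsetl.
  rewrite [X in _ + X](_ : _ = 0) ?addr0//.
  apply: (T_negligibleS H_hilbert T_AL _ _ _ CB0).
  - by apply: borel_achronalS bC; [exact: borelD|exact: subDsetl].
  - exact: borelD.
  - by move=> x [[]].
have TSC : T (S `&` C) v = v - T (S `\` C) v.
  rewrite -{2}(al_complement T_AL v mS mCS (@subIsetl _ _ _)).
  by rewrite setDIr setDv set0U addrK.
have BSC x y : B x -> (S `\` C) y -> minksq (x - y) < 0.
  move=> Bx [Sy nCy]; rewrite minksqBC ltNge; apply/negP => yx; apply: nCy.
  by apply: DC; split => //; exists x => //; exact: BD.
have aU : achronal (B `|` S `\` C).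
  apply: achronalU; first exact: achronalS aD.
    by apply: achronalS aS; exact: subDsetl.
  by move=> x y Bx ny; exact/ltW/BSC.
have dU : B `&` (S `\` C) = set0.
  apply/seteqP; split => // x [Bx nx]; have := BSC _ _ Bx nx.
  by rewrite subrr /minksq /mink !mxE; lra.
(* Since [B] and [S \ C] are disjoint with achronal union, the sum of their operators is at most the
   identity, and the identity minus the second is the value at [B']. *)
have := al_le1 T_AL v (conj (borelU mB mSC) aU).
rewrite (al_setU T_AL v mB mSC aU dU) -subr_ge0 -linearBl.
by rewrite -TB' TSC -addrA -opprD [X in v - X]addrC.
Qed.

End Causality.

Theorem mainTheorem4 (R : realType)
    (H : completeNormedModType R[i]) (dot : {dot H for Num.conj})
    (H_hilbert : inner_product_norm dot) (H_separable : separable H)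
    (T : set 'rV[R]_4 -> {linear H -> H})
    (T_AL : achronal_localization dot T)
    (Delta Sigma : set 'rV[R]_4)
    (Delta_achronal : achronal Delta) (Sigma_base : causal_base Sigma) :
  (suslin Delta -> T_measurable T (region_of_influence Delta Sigma)) /\
  (T_measurable T Delta -> T_measurable T (region_of_influence Delta Sigma) ->
   le_op dot (T_ext T Delta) (T_ext T (region_of_influence Delta Sigma))).
Proof.
have mS := causal_base_maximal_achronal Sigma_base.
split; first exact: (region_of_influence_measurable H_hilbert T_AL).
exact: (causality H_hilbert T_AL).
Qed.
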